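(* Let $f:\mathbb{R}\to[0,\infty)$ be a convex function, let $F(a,b)=f(a)+f(b)$, and let $\mu$ be the density of a Lévy measure with low singularity. Then $\rho(a,b;x,y)=F(a,b)\,\mu(|x-y|)$ is a homogeneous jump kernel.
   Context: Density of a Lévy measure with low singularity: a non-negative (Borel) function $\mu:[0,\infty)\to[0,\infty)$ with $\int_{\mathbb{R}^N}(1\wedge|y|)\,\mu(|y|)\,dy<\infty$. Homogeneous jump kernel: a function $\rho:(\mathbb{R}\times\mathbb{R})\times(\mathbb{R}^N\times\mathbb{R}^N)\to\mathbb{R}$, written $\rho(a,b;x,y)$, such that for all $a,b,c,d\in\mathbb{R}$ and almost every $(x,y)\in\mathbb{R}^N\times\mathbb{R}^N$: (A1) $\rho$ is a non-negative Borel function; (A2) $\rho(a,b;x,y)=\rho(b,a;y,x)$; (A3) $(a-b)\rho(a,b;x,y)\ge(c-d)\rho(c,d;x,y)$ whenever $a\ge c\ge d\ge b$; (A4) $\rho(a,b;x,y)=\rho(a,b;|x-y|)$, i.e. $\rho$ depends on $x,y$ only through $|x-y|$; (A5) for every $R>0$ there is a function $m_R:[0,\infty)\to[0,\infty)$ such that $\sup_{-R\le a,b\le R}\rho(a,b;x,y)\le m_R(|x-y|)$ and $\int_{\mathbb{R}^N}(1\wedge|y|)\,m_R(|y|)\,dy=K_R<\infty$; (A6) $\rho$ is continuous with respect to the first two variables, and for every $\varepsilon>0$ and every $R>\varepsilon$ there is a constant $C_{R,\varepsilon}$ such that $|\rho(a,b;x,y)-\rho(c,d;x,y)|\le C_{R,\varepsilon}(|a-c|+|b-d|)\,m_R(|x-y|)$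 for all $a,b,c,d\in[-R,R]$ with $|a-b|\ge\varepsilon$ and $|c-d|\ge\varepsilon$. *)

(* Defs.v *)
From HB Require Import structures.
From mathcomp Require Import all_boot all_order all_algebra.
From mathcomp Require Import all_classical all_reals all_analysis.
Import Order.TTheory GRing.Theory Num.Theory numFieldNormedType.Exports.

Set Implicit Arguments.
Unset Strict Implicit.
Unset Printing Implicit Defensive.

Local Open Scope classical_set_scope.
Local Open Scope ring_scope.

(* The sigma-algebra of the type of tuples is generated by the coordinate
   projections; it is therefore the Borel sigma-algebra of R^N. *)
Notation euclid R N := (N.-tuple (measurableTypeR R)).

Section euclidean_space.
Context {R : realType}.

Definition esub {N} (x y : euclid R N) : euclid R N :=
  [tuple (tnth x i : R) - (tnth y i : R) | i < N].

Definition enorm {N} (x : euclid R N) : R :=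
  Num.sqrt (\sum_(i < N) (tnth x i : R) ^+ 2).

Definition econs {N} (p : measurableTypeR R * euclid R N) : euclid R N.+1 :=
  [tuple of p.1 :: p.2].

Lemma measurable_econs N : measurable_fun setT (@econs N).
Proof. exact: (@measurable_cons _ _ _ (measurableTypeR R) fst N snd). Qed.

End euclidean_space.

(* The image of the product of the Lebesgue measure on R and of a measure on
   R^N under the identification of R * R^N with R^(N+1). *)
Section lebesgue_step.
Context {R : realType} {N : nat}.
Variable m : {sigma_finite_measure set (euclid R N) -> \bar R}.

Local Notation prod := (@lebesgue_measure R \x m)%E.

Definition lebesgue_step : set (euclid R N.+1) -> \bar R :=
  pushforward prod econs.

Let step0 : lebesgue_step set0 = 0%E.
Proof. by rewrite /lebesgue_step /pushforward preimage_set0 measure0. Qed.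

Let step_ge0 A : (0 <= lebesgue_step A)%E.
Proof. by rewrite /lebesgue_step /pushforward measure_ge0. Qed.

Let step_sigma_additive : semi_sigma_additive lebesgue_step.
Proof.
move=> F mF tF mUF; rewrite /lebesgue_step /pushforward preimage_bigcup.
apply: measure_semi_sigma_additive.
- by move=> n; rewrite -[X in measurable X]setTI; exact: measurable_econs.
- apply/trivIsetP => /= i j _ _ ij; rewrite -preimage_setI.
  by move/trivIsetP : tF => /(_ _ _ _ _ ij) ->//; rewrite preimage_set0.
- by rewrite -preimage_bigcup -[X in measurable X]setTI; exact: measurable_econs.
Qed.

HB.instance Definition _ := isMeasure.Build _ _ _ lebesgue_step
  step0 step_ge0 step_sigma_additive.

Let step_sigma_finite : sigma_finite setT lebesgue_step.
Proof.
have /sigma_finiteP[F [TF ndF Foo]] := sigma_finiteT (@lebesgue_measure R).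
have /sigma_finiteP[G [TG ndG Goo]] := sigma_finiteT m.
pose g (t : euclid R N.+1) : measurableTypeR R * euclid R N :=
  (thead t, [tuple of behead t]).
have mg : measurable_fun setT g.
  apply/measurable_fun_pairP; split; first exact: measurable_tnth.
  exact: measurable_behead.
have gK : cancel econs g.
  by move=> [x t]; rewrite /g /econs /=; congr pair; apply/val_inj.
have FGT : \bigcup_n (F n `*` G n) = setT.
  rewrite -setXTT TF TG predeqE => -[x y]; split.
    by move=> [n _ []/= ? ?]; split; exists n.
  move=> [/= [n _ Fnx] [k _ Gky]]; exists (maxn n k) => //; split.
  - by move: x Fnx; exact/subsetPset/ndF/leq_maxl.
  - by move: y Gky; exact/subsetPset/ndG/leq_maxr.
exists (fun n => g @^-1` (F n `*` G n)).
  by rewrite -preimage_bigcup FGT preimage_setT.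
move=> n; have [mF Fn] := Foo n; have [mG Gn] := Goo n; split.
  by rewrite -[X in measurable X]setTI; apply: mg => //; exact: measurableX.
rewrite /lebesgue_step /pushforward -comp_preimage (_ : g \o econs = id).
  by rewrite preimage_id product_measure1E// lte_mul_pinfty// ge0_fin_numE.
by apply/funext => p /=; rewrite gK.
Qed.

HB.instance Definition _ := Measure_isSigmaFinite.Build _ _ _ lebesgue_step
  step_sigma_finite.

End lebesgue_step.

Fixpoint lebesgueN {R : realType} {N : nat} :
    {sigma_finite_measure set (euclid R N) -> \bar R} :=
  match N with
  | 0 => \d_ [tuple]
  | N'.+1 => lebesgue_step (@lebesgueN R N')
  end.

Lemma lebesgueN_box {R : realType} {N : nat} (A : 'I_N -> set (measurableTypeR R)) :
  (forall i, measurable (A i)) ->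
  lebesgueN [set x : euclid R N | forall i, A i (tnth x i)] =
  \big[*%E/1%E]_(i < N) lebesgue_measure (A i).
Proof.
elim: N A => [|N IHN] A mA.
  by rewrite big_ord0 /= diracE mem_set// => -[].
rewrite big_ord_recl -(IHN (fun i => A (lift ord0 i)))//= /lebesgue_step.
rewrite /pushforward -product_measure1E//; last first.
  rewrite (_ : mkset _ = \big[setI/setT]_(i < N)
      ((fun x : euclid R N => tnth x i) @^-1` A (lift ord0 i))).
    apply: bigsetI_measurable => i _; rewrite -[X in measurable X]setTI.
    exact: measurable_tnth.
  rewrite -bigcap_seq; apply/seteqP; split=> [x Ax i _|x Ax i]; first exact: Ax.
  by apply: Ax; rewrite /= mem_index_enum.
congr (_ _); apply/seteqP; split => -[x t] /=.
  move=> Axt; split; first exact: (Axt ord0).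
  by move=> i; have := Axt (lift ord0 i); rewrite tnthS.
by move=> [Ax At] i; case: (unliftP ord0 i) => [j ->|->//]; rewrite tnthS.
Qed.

Section jump_kernels.
Context {R : realType} {N : nat}.

Local Notation E := (euclid R N).

Definition low_singularity (m : R -> R) : Prop :=
  (\int[@lebesgueN R N]_y (Num.min 1 (enorm y) * m (enorm y))%:E < +oo)%E.

(* A function [0, +oo[ -> [0, +oo[ is encoded by a total function on R, of which
   only the values on [0, +oo[ matter. *)
Definition nneg_borel (m : R -> R) : Prop :=
  measurable_fun (`[0, +oo[ : set (measurableTypeR R)) m /\
  forall r, 0 <= r -> 0 <= m r.

Definition levy_density_low_singularity (mu : R -> R) : Prop :=
  nneg_borel mu /\ low_singularity mu.

Local Notation lebesgue2 := (@lebesgueN R N \x @lebesgueN R N)%E.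

Definition locally_dominated (rho : R -> R -> E -> E -> R) (m : R -> R -> R) :=
  forall r, 0 < r ->
  [/\ nneg_borel (m r), low_singularity (m r) &
    {ae lebesgue2, forall z : E * E,
      (ereal_sup [set (rho a b z.1 z.2)%:E | a in `[(- r)%R, r] & b in `[(- r)%R, r]]
       <= (m r (enorm (esub z.1 z.2)))%:E)%E}].

Definition locally_lipschitz_off_diagonal
    (rho : R -> R -> E -> E -> R) (m : R -> R -> R) :=
  forall e r, 0 < e -> e < r -> exists C, forall a b c d,
    a \in `[- r, r] -> b \in `[- r, r] -> c \in `[- r, r] -> d \in `[- r, r] ->
    e <= `|a - b| -> e <= `|c - d| ->
    {ae lebesgue2, forall z : E * E,
      `|rho a b z.1 z.2 - rho c d z.1 z.2| <=
      C * (`|a - c| + `|b - d|) * m r (enorm (esub z.1 z.2))}.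

(* The parameters a, b, c, d are quantified outside "for almost every (x, y)",
   hence the exceptional null sets may depend on them, except where the property
   is about the whole function (a, b) |-> rho a b x y (supremum, continuity).
   The two local bounds share the same family m of dominating functions. *)
Record homogeneous_jump_kernel (rho : R -> R -> E -> E -> R) : Prop := {
  kernel_ge0 : forall a b x y, 0 <= rho a b x y;
  kernel_borel : measurable_fun
    [set: (measurableTypeR R * measurableTypeR R) * (E * E)]
    (fun p => rho p.1.1 p.1.2 p.2.1 p.2.2);
  kernel_sym : forall a b,
    {ae lebesgue2, forall z : E * E,
      rho a b z.1 z.2 = rho b a z.2 z.1};
  kernel_mono : forall a b c d, b <= d -> d <= c -> c <= a ->
    {ae lebesgue2, forall z : E * E,
      (c - d) * rho c d z.1 z.2 <= (a - b) * rho a b z.1 z.2};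
  kernel_homogeneous : exists rho0 : R -> R -> R -> R,
    forall a b,
    {ae lebesgue2, forall z : E * E,
      rho a b z.1 z.2 = rho0 a b (enorm (esub z.1 z.2))};
  kernel_continuous :
    {ae lebesgue2, forall z : E * E,
      continuous (fun ab : R * R => rho ab.1 ab.2 z.1 z.2)};
  kernel_local_bounds : exists m : R -> R -> R,
    locally_dominated rho m /\ locally_lipschitz_off_diagonal rho m
}.

End jump_kernels.

(* Main.v *)
Require Import Defs.
From mathcomp Require Import all_boot all_order all_algebra.
From mathcomp Require Import all_classical all_reals all_analysis.
From mathcomp Require Import measurable_realfun ring lra.
Import Order.TTheory GRing.Theory Num.Theory numFieldNormedType.Exports.
Local Open Scope classical_set_scope.
Local Open Scope ring_scope.

(** Almost everything reduces to facts about the convex function f alone,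
    because the kernel factors as F(a, b) times a function of |x - y|.

    Monotonicity: if b <= d <= c <= a then c and d are convex combinations
    of a and b, so (a - b) (f c + f d) is at most
    (2a - c - d) f b + (c + d - 2b) f a. Multiplying by c - d, both coefficients
    become differences of squares, (a - d)^2 - (a - c)^2 and
    (c - b)^2 - (d - b)^2, hence are at most (a - b)^2; as f >= 0 the claim
    follows ([convex_spread]).

    Regularity: a non-negative convex function is bounded on [-r, r] by the sum
    of its values at the endpoints ([convex_le_endpoints]), and it is Lipschitz
    there because its slopes are controlled by the chords reaching one unit
    beyond the interval ([convex_lipschitz]). Hence f is continuous, therefore
    Borel.

    The dominating functions are m_r = (1 + 2 (f r + f (- r))) mu. A multiple
    of mu satisfies the same integrability condition, 2 (f r + f (- r)) bounds F
    on [-r, r]^2, and the extra 1 gives mu <= m_r even when f vanishes on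
    [-r, r]; the Lipschitz constant of f on [-r, r] then serves
    as the constant of the Lipschitz bound of the kernel. *)

Section convex_real.
Context {R : realType}.
Implicit Types (f : R -> R) (a b c d r x y z : R).

(** Convexity in a form without quotients, which stays true when x = z. *)
Lemma convex_three_points f x y z :
  convex_function [set: convex_lmodType R^o] f -> x <= y -> y <= z ->
  (z - x) * f y <= (z - y) * f x + (y - x) * f z.
Proof.
move=> cvx xy yz.
have [xz|zx] := ltP x z; last first.
  have -> : z = x by apply/le_anti; rewrite zx (le_trans xy yz).
  have -> : y = x by apply/le_anti; rewrite xy (le_trans yz zx).
  by rewrite !subrr !mul0r addr0.
have zx0 : 0 < z - x by rewrite subr_gt0.
have t0 : 0 <= (z - y) / (z - x) by rewrite divr_ge0// ?subr_ge0// ltW.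
have t1 : (z - y) / (z - x) <= 1 by rewrite ler_pdivrMr// mul1r; lra.
pose t := (z - y) / (z - x).
have : f (t * x + (1 - t) * z) <= t * f x + (1 - t) * f z.
  exact: (cvx (Itv01 t0 t1) x z (mem_set I) (mem_set I)).
have nz : z - x != 0 by rewrite gt_eqF.
have -> : t * x + (1 - t) * z = y by rewrite /t; field.
rewrite -(ler_pM2l zx0); congr (_ <= _).
by rewrite /t; field.
Qed.

(** Bounding f c and f d separately by max(f a, f b) would lose: it only gives
    2 (c - d) max(f a, f b), which can exceed the right-hand side when one of
    f a, f b vanishes. The weights of the convex combinations are needed. *)
Lemma convex_spread f a b c d :
  convex_function [set: convex_lmodType R^o] f -> (forall x, 0 <= f x) ->
  b <= d -> d <= c -> c <= a ->
  (c - d) * (f c + f d) <= (a - b) * (f a + f b).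
Proof.
move=> cvx f0 bd dc ca.
have [ba|ab] := ltP b a; last first.
  have -> : c = d by lra.
  have -> : a = b by lra.
  by rewrite !subrr !mul0r.
have hc := convex_three_points f b c a cvx (le_trans bd dc) ca.
have hd := convex_three_points f b d a cvx bd (le_trans dc ca).
have ab0 : 0 < a - b by rewrite subr_gt0.
rewrite -(ler_pM2l ab0).
have cd0 : 0 <= c - d by rewrite subr_ge0.
have h : (a - b) * (f c + f d) <=
    ((a - c) + (a - d)) * f b + ((c - b) + (d - b)) * f a by lra.
have := ler_wpM2l cd0 h.
(* The coefficients are (a - d)^2 - (a - c)^2 and (c - b)^2 - (d - b)^2. *)
have hb : (c - d) * ((a - c) + (a - d)) * f b <= (a - b) ^+ 2 * f b.
  by apply: ler_wpM2r; [exact: f0|nra].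
have ha : (c - d) * ((c - b) + (d - b)) * f a <= (a - b) ^+ 2 * f a.
  by apply: ler_wpM2r; [exact: f0|nra].
by move: ha hb; rewrite expr2; lra.
Qed.

Lemma convex_le_endpoints f r a :
  convex_function [set: convex_lmodType R^o] f -> (forall x, 0 <= f x) ->
  0 < r -> a \in `[- r, r] -> f a <= f r + f (- r).
Proof.
move=> cvx f0 r0; rewrite in_itv/= => /andP[ra ar].
have h := convex_three_points f (- r) a r cvx ra ar.
have r2 : 0 < r - (- r) by lra.
rewrite -(ler_pM2l r2) (le_trans h)//.
have h1 := f0 r; have h2 := f0 (- r).
by nra.
Qed.

(** The chord from a to the point r + 1 has length at least 1 and f >= 0, so
    its slope is at most f (r + 1); the slope downwards is controlled in the
    same way by the value at - r - 1. *)
Lemma convex_lipschitz f r a c :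
  convex_function [set: convex_lmodType R^o] f -> (forall x, 0 <= f x) ->
  a \in `[- r, r] -> c \in `[- r, r] ->
  `|f a - f c| <= (f (r + 1) + f (- r - 1)) * `|a - c|.
Proof.
move=> cvx f0.
wlog ac : a c / a <= c.
  move=> wlg ar cr; have [ac|/ltW ca] := leP a c; first exact: wlg.
  by rewrite distrC (distrC a); exact: wlg.
rewrite !in_itv/= => /andP[ra ar] /andP[rc cr].
rewrite (distrC a) (ger0_norm (_ : 0 <= c - a)) ?subr_ge0//.
have ca0 : 0 <= c - a by rewrite subr_ge0.
have fp := f0 (r + 1); have fm := f0 (- r - 1); have fa := f0 a; have fc := f0 c.
have up := convex_three_points f a c (r + 1) cvx ac (ltac:(lra)).
have lo := convex_three_points f (- r - 1) a c cvx (ltac:(lra)) ac.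
have up' : f c - f a <= (c - a) * f (r + 1).
  have [|h] := leP (f c) (f a); first by nra.
  have : 1 * (f c - f a) <= (r + 1 - a) * (f c - f a) by apply: ler_wpM2r; lra.
  have : 0 <= (c - a) * f a by apply: mulr_ge0.
  by lra.
have lo' : f a - f c <= (c - a) * f (- r - 1).
  have [|h] := leP (f a) (f c); first by nra.
  have : 1 * (f a - f c) <= (c + r + 1) * (f a - f c) by apply: ler_wpM2r; lra.
  have : 0 <= (c - a) * f c by apply: mulr_ge0.
  by lra.
have fpca : 0 <= (c - a) * f (r + 1) by apply: mulr_ge0.
have fmca : 0 <= (c - a) * f (- r - 1) by apply: mulr_ge0.
by rewrite ler_norml; lra.
Qed.

Lemma convex_continuous f :
  convex_function [set: convex_lmodType R^o] f -> (forall x, 0 <= f x) ->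
  continuous f.
Proof.
move=> cvx f0 x; apply/cvgrPdist_lt => e e0.
pose r := `|x| + 1; pose L := f (r + 1) + f (- r - 1).
have L1 : 0 < L + 1 by rewrite ltr_wpDl// addr_ge0.
near=> y.
have xy1 : `|x - y| < 1 by near: y; exact: cvgr_dist_lt.
have xye : `|x - y| < e / (L + 1).
  by near: y; apply: cvgr_dist_lt => //; exact: divr_gt0.
have inr z : `|x - z| < 1 -> z \in `[- r, r].
  rewrite in_itv/= -ler_norml /r => /ltW xz1.
  have := ler_normD (z - x) x; rewrite subrK (distrC z); lra.
apply: (le_lt_trans (convex_lipschitz f r x y cvx f0 _ _)).
- by apply: inr; rewrite subrr normr0.
- exact: inr.
- rewrite -/L; move: xye; rewrite ltr_pdivlMr// => xye.
  by rewrite (le_lt_trans _ xye)// mulrC ler_wpM2l//; lra.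
Unshelve. all: by end_near. Qed.

End convex_real.

Section radial.
Context {R : realType} {N : nat}.
Local Notation E := (euclid R N).

Lemma measurable_enorm : measurable_fun setT (@enorm R N).
Proof.
apply: (@measurableT_comp _ _ _ _ _ _ (@Num.sqrt R)).
  apply: continuous_measurable_fun; exact: sqrt_continuous.
apply: measurable_sum => i; apply: measurable_funX.
exact: measurable_tnth.
Qed.

Lemma measurable_esub :
  measurable_fun setT (fun z : E * E => esub z.1 z.2).
Proof.
apply/measurable_fun_tnthP => i.
rewrite (_ : _ \o _ = fun z : E * E => (tnth z.1 i : R) - (tnth z.2 i : R)).
  by apply: measurable_funB; apply: (measurableT_comp (measurable_tnth i)).
by apply/funext => z /=; rewrite tnth_mktuple.
Qed.

Lemma enorm_ge0 (x : E) : 0 <= enorm x.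
Proof. exact: sqrtr_ge0. Qed.

Lemma measurable_radial (m : R -> R) :
  nneg_borel m -> measurable_fun setT (m \o @enorm R N).
Proof.
move=> [mm _]; apply: (measurable_comp _ _ mm measurable_enorm).
  exact: measurable_itv.
by move=> _ [x _ <-] /=; rewrite in_itv/= enorm_ge0.
Qed.

Lemma levy_density_scale (k : R) (m : R -> R) : 0 <= k ->
  levy_density_low_singularity (N := N) m ->
  levy_density_low_singularity (N := N) (fun s => k * m s).
Proof.
move=> k0 [nbm lsm]; have [mm m0] := nbm; split.
  split=> [|s s0]; last by rewrite mulr_ge0// m0.
  exact: measurable_funM.
rewrite /low_singularity.
under eq_integral do rewrite mulrCA EFinM.
rewrite ge0_integralZl_EFin//.
- by rewrite lte_mul_pinfty.
- by move=> y _; rewrite lee_fin mulr_ge0// ?m0 ?enorm_ge0// le_min ler01 enorm_ge0.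
- apply/measurable_EFinP; apply: measurable_funM.
    apply: measurable_minr => //; exact: measurable_enorm.
  exact: measurable_radial.
Qed.

End radial.

Theorem proposition5p5 (R : realType) (N : nat) (f : R -> R) (mu : R -> R)
    (f_ge0 : forall a, 0 <= f a)
    (f_convex : convex_function [set: convex_lmodType R^o] f)
    (mu_levy : levy_density_low_singularity (N := N) mu) :
  let F a b := f a + f b in
  homogeneous_jump_kernel
    (fun (a b : R) (x y : euclid R N) => F a b * mu (enorm (esub x y))).
Proof.
move=> F; have [nbmu _] := mu_levy; have [_ mu0] := nbmu.
have F0 a b : 0 <= F a b by rewrite addr_ge0.
have mu_ge0 (x : euclid R N) : 0 <= mu (enorm x) by rewrite mu0 ?enorm_ge0.
have fcont := convex_continuous f f_convex f_ge0.
have enorm_sym (x y : euclid R N) : enorm (esub x y) = enorm (esub y x).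
  rewrite /enorm; congr Num.sqrt; apply: eq_bigr => i _.
  by rewrite !tnth_mktuple -sqrrN opprB.
split.
- by move=> a b x y; rewrite mulr_ge0.
- have mf : measurable_fun [set: measurableTypeR R] f.
    exact: continuous_measurable_fun.
  apply: measurable_funM.
    by apply: measurable_funD; apply: measurableT_comp => //;
      apply: measurableT_comp.
  apply: (measurableT_comp (measurable_radial mu nbmu)).
  exact: (measurableT_comp measurable_esub).
- by move=> a b; apply: aeW => z; rewrite /F addrC enorm_sym.
- move=> a b c d bd dc ca; apply: aeW => z.
  by rewrite !mulrA ler_wpM2r// convex_spread.
- by exists (fun a b s => F a b * mu s) => a b; exact: aeW.
- apply: aeW => z ab; apply: cvgM; last exact: cvg_cst.
  apply: cvgD.
    by apply: (continuous_comp (f := fst)); [exact: cvg_fst|exact: fcont].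
  by apply: (continuous_comp (f := snd)); [exact: cvg_snd|exact: fcont].
- pose k r := 1 + 2 * (f r + f (- r)).
  exists (fun r s => k r * mu s); split.
    move=> r r0.
    have k0 : 0 <= k r by have := F0 r (- r); rewrite /k /F; lra.
    have [nb ls] := levy_density_scale _ _ k0 mu_levy; split=> //.
    apply: aeW => z; apply/ereal_supP => _ [a ar [b br <-]].
    rewrite lee_fin ler_wpM2r// /F /k.
    have := convex_le_endpoints f r a f_convex f_ge0 r0 ar.
    have := convex_le_endpoints f r b f_convex f_ge0 r0 br.
    by lra.
  move=> e r e0 er; pose L := f (r + 1) + f (- r - 1); exists L.
  move=> a b c d ar br cr dr _ _; apply: aeW => z.
  rewrite -mulrBl normrM (ger0_norm (mu_ge0 _)).
  have mukmu : mu (enorm (esub z.1 z.2)) <= k r * mu (enorm (esub z.1 z.2)).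
    by rewrite -[leLHS]mul1r ler_wpM2r// /k lerDl mulr_ge0// F0.
  apply: ler_pM => //.
  rewrite /F opprD addrACA mulrDr (le_trans (ler_normD _ _))// lerD//.
    exact: convex_lipschitz.
  exact: convex_lipschitz.
Qed.
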